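(* There exist a countable set $\mathcal{M}\subset\mathbb{H}^d$ and a constant $c_d\in\mathbb{N}$ such that $$\bigcup_{x\in\mathcal{M}}\mathbb{B}(x,1/2)=\mathbb{H}^d$$ and $$|\{x\in\mathcal{M}:y\in\mathbb{B}(x,1/2)\}|\le c_d\quad\text{for all }y\in\mathbb{H}^d.$$
   Context: $\mathbb{H}^d$ ($d\ge2$) is $d$-dimensional hyperbolic space of constant curvature $-1$ with metric $d_h$; $\mathbb{B}(x,r)=\{z\in\mathbb{H}^d:d_h(z,x)\le r\}$; $|A|$ is the cardinality of a set $A$. *)

(* Defs.v *)
From mathcomp Require Import all_boot all_order all_algebra.
From mathcomp Require Import ring lra.
From mathcomp Require Import all_classical all_reals all_analysis.

Set Implicit Arguments.
Unset Strict Implicit.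
Unset Printing Implicit Defensive.

Import Order.TTheory GRing.Theory Num.Theory.

Local Open Scope classical_set_scope.
Local Open Scope ring_scope.

Definition arcosh (R : realType) (x : R) : R := ln (x + Num.sqrt (x ^+ 2 - 1)).

(* [arcosh] is the nonnegative inverse of cosh on [1, +oo[. *)
Lemma arcosh_ge0 (R : realType) (x : R) : 1 <= x -> 0 <= arcosh x.
Proof.
by move=> x1; apply: ln_ge0; apply: (le_trans x1); rewrite lerDl sqrtr_ge0.
Qed.

Lemma arcoshK (R : realType) (x : R) :
  1 <= x -> (expR (arcosh x) + expR (- arcosh x)) / 2 = x.
Proof.
move=> x1; set s := Num.sqrt (x ^+ 2 - 1).
have s0 : 0 <= s by exact: sqrtr_ge0.
have ss : s ^+ 2 = x ^+ 2 - 1 by rewrite sqr_sqrtr//; nra.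
have xs : 0 < x + s by lra.
rewrite expRN /arcosh -/s lnK ?posrE//.
have -> : (x + s)^-1 = x - s.
  apply: (mulfI (lt0r_neq0 xs)); rewrite mulfV ?gt_eqF//.
  by rewrite mulrC -subr_sqr ss; ring.
by field.
Qed.

(* Hyperbolic [d]-space in the Poincare upper half-space model:
   the points (v, t) of R^(d-1) x ]0, +oo[. *)
Record hyperbolic (R : realType) (d : nat) := Hyperbolic {
  hbase : 'rV[R]_(d.-1) ;
  height : R ;
  height_gt0 : 0 < height
}.

(* The squared Euclidean distance in R^d; the library norm on row vectors
   is the sup norm, hence the explicit sum. *)
Definition sqdist (R : realType) (d : nat) (x y : hyperbolic R d) : R :=
  \sum_(i < d.-1) (hbase x 0 i - hbase y 0 i) ^+ 2 + (height x - height y) ^+ 2.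

(* The geodesic distance of the Riemannian metric (|dv|^2 + dt^2) / t^2, of
   curvature -1: cosh d_h(x, y) = 1 + |x - y|^2 / (2 t_x t_y). *)
Definition hdist (R : realType) (d : nat) (x y : hyperbolic R d) : R :=
  arcosh (1 + sqdist x y / (2 * height x * height y)).

Definition hball (R : realType) (d : nat) (x : hyperbolic R d) (r : R) :
    set (hyperbolic R d) :=
  [set z | hdist z x <= r].

(* Main.v *)
Require Import Defs.
From mathcomp Require Import all_boot all_order all_algebra.
From mathcomp Require Import ring lra zify.
From mathcomp Require Import all_classical all_reals all_analysis.

(** In the upper half-space model the scalings (v, t) -> (s v, s t) and the
    horizontal translations are isometries, so a net can be written down
    explicitly. Fix a mesh delta and take the points of height
    s = (1 + delta)^k, with k an integer, whose base lies in the lattice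
    delta s Z^(d-1): up to isometry every layer looks like the layer s = 1.

    The link with the metric is [hballE]: z is in the closed ball of radius r
    about x exactly when the squared Euclidean distance |z - x|^2 is at most
    kappa t_x t_z, where kappa = 2 (cosh r - 1) ([chord2]).

    Covering ([net_point_cover]): rounding down the two kinds of coordinates
    (log t / log (1 + delta), then v_i / (delta s)) moves a point of height t
    by at most delta s in each of the d directions, while s <= t; so it is
    enough that d delta^2 <= kappa.

    Bounded multiplicity ([net_point_window]): if the net point of index (k, n)
    is within r of y, then comparing heights shows that s and t are within a
    factor kappa + 2 of each other, hence k is within a bounded distance of its
    real coordinate for y; then |v - delta s n| <= (kappa + 2) s does the same
    for each n_i. So the index lies in a window of integers around the rounded
    coordinates of y, and the size of that window depends only on r and d.

    Nothing is special about the radius 1/2: [hyperbolic_net] gives the result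
    for any r > 0. *)

Import Order.TTheory GRing.Theory Num.Theory.

Local Open Scope classical_set_scope.
Local Open Scope card_scope.
Local Open Scope ring_scope.

(** This is 2 (cosh r - 1) = (2 sinh (r / 2))^2, the squared Minkowski length of
    the chord joining two points at distance r in the hyperboloid model. *)
Definition chord2 {R : realType} (r : R) : R := expR r + expR (- r) - 2.

Lemma chord2_gt0 {R : realType} (r : R) : 0 < r -> 0 < chord2 r.
Proof.
move=> r0; rewrite /chord2 expRN.
have e1 : 1 < expR r by have := expR_ge1Dx r; lra.
have -> : expR r + (expR r)^-1 - 2 = (expR r - 1) ^+ 2 / expR r.
  by field; rewrite gt_eqF// expR_gt0.
by rewrite divr_gt0 ?exprn_gt0 ?expR_gt0// subr_gt0.
Qed.

(** With A = e^(arcosh u) and B = e^r, both at least 1, the claim is that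
    A + 1/A <= B + 1/B is equivalent to A <= B, which follows from
    (B + 1/B) - (A + 1/A) = (B - A) (1 - 1/(A B)). *)
Lemma arcosh_le {R : realType} (u r : R) : 1 <= u -> 0 <= r ->
  (arcosh u <= r) = (2 * u <= expR r + expR (- r)).
Proof.
move=> u1 r0; rewrite -{2}(arcoshK u1) -ler_expR !expRN.
have : 1 <= expR (arcosh u).
  by have := expR_ge1Dx (arcosh u); have := arcosh_ge0 u1; lra.
have : 1 <= expR r by have := expR_ge1Dx r; lra.
move: (expR (arcosh u)) (expR r) => A B B1 A1.
have A0 : 0 < A by lra.
have B0 : 0 < B by lra.
have E : B + B^-1 - (A + A^-1) = (B - A) * (A * B - 1) / (A * B).
  by field; rewrite !gt_eqF.
rewrite mulrC divfK ?pnatr_eq0// -[RHS]subr_ge0 E pmulr_lge0 ?invr_gt0 ?mulr_gt0//.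
apply/idP/idP => [AB|]; first by rewrite mulr_ge0 ?subr_ge0 ?mulr_ege1.
rewrite !leNgt; apply: contra => BA.
by rewrite nmulr_rlt0 ?subr_lt0// subr_gt0; nra.
Qed.

Lemma sqdist_ge0 {R : realType} {d : nat} (x y : hyperbolic R d) :
  0 <= sqdist x y.
Proof. by rewrite addr_ge0 ?sqr_ge0// sumr_ge0// => i _; rewrite sqr_ge0. Qed.

Lemma hballE {R : realType} {d : nat} (x z : hyperbolic R d) (r : R) : 0 <= r ->
  hball x r z <-> sqdist z x <= chord2 r * (height z * height x).
Proof.
move=> r0; rewrite /hball /= /hdist.
have tz := height_gt0 z; have tx := height_gt0 x.
have h0 : 0 < height z * height x by rewrite mulr_gt0.
have q0 : 0 <= sqdist z x / (2 * height z * height x).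
  by rewrite divr_ge0 ?sqdist_ge0// -mulrA mulr_ge0// ltW.
rewrite arcosh_le//; last by lra.
rewrite -ler_pdivrMr// /chord2.
have -> : 2 * (1 + sqdist z x / (2 * height z * height x)) =
          2 + sqdist z x / (height z * height x).
  by field; rewrite !gt_eqF.
by split; lra.
Qed.

(** An integer within L of u is one of boundedly many offsets of floor u. The 2
    absorbs the rounding of u and the truncation of L. *)
Lemma int_near_floor {R : realType} (u L : R) (N : nat) (n : int) :
  (Num.truncn L + 2 <= N)%N -> `|n%:~R - u| <= L ->
  exists j : 'I_(N.*2.+1), n = Num.floor u + j%:Z - N%:Z.
Proof.
move=> LN nuL.
have LtN : L + 1 < N%:R.
  have := truncnS_gt L.
  have : (Num.truncn L + 2)%:R <= N%:R :> R by rewrite ler_nat.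
  by rewrite -natr1 natrD; lra.
have := floor_itv u; rewrite intrD => /andP[f1 f2].
move: nuL; rewrite ler_norml => /andP[n1 n2].
have hi : n - Num.floor u < N%:Z.
  by rewrite -(ltr_int R) intrB; change (N%:Z%:~R) with (N%:R : R); lra.
have lo : - N%:Z < n - Num.floor u.
  by rewrite -(ltr_int R) intrB intrN; change (N%:Z%:~R) with (N%:R : R); lra.
have jN : (absz (n - Num.floor u + N%:Z)%R < N.*2.+1)%N by lia.
by exists (Ordinal jN) => /=; lia.
Qed.

Lemma range_card_le {T : finType} {U : Type} (S : set U) (f : T -> U) :
  S `<=` range f -> S #<= `I_#|T|.
Proof.
move=> Sf; rewrite (card_le_eqr card_II).
apply: card_le_trans (card_image_le (f \o enum_val) _).
apply: subset_card_le => x /Sf[t _ <-].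
by exists (enum_rank t); rewrite //= enum_rankK.
Qed.

(** Heights are spaced geometrically, and the horizontal mesh of a layer is
    proportional to its height. *)
Definition net_point {R : realType} {d : nat} (delta : R)
    (p : int * {ffun 'I_d.-1 -> int}) : hyperbolic R d :=
  let s := expR (p.1%:~R * ln (1 + delta)) in
  @Hyperbolic R d (\row_i (delta * s * (p.2 i)%:~R)) s (expR_gt0 _).

(** [layer_coord] and [base_coord] are the real coordinates of which the index of
    a net point is the integer value: y itself would be
    [net_point delta (layer_coord delta y, base_coord delta _ y)] if integrality
    could be dropped. Horizontal coordinates are taken relative to a layer k. *)
Definition layer_coord {R : realType} {d : nat} (delta : R)
  (y : hyperbolic R d) : R := ln (height y) / ln (1 + delta).

Definition base_coord {R : realType} {d : nat} (delta : R) (k : int)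
    (y : hyperbolic R d) (i : 'I_d.-1) : R :=
  hbase y 0 i / (delta * expR (k%:~R * ln (1 + delta))).

Lemma net_point_cover {R : realType} {d : nat} (delta r : R) (y : hyperbolic R d) :
  0 < delta -> 0 <= r -> (d.-1).+1%:R * delta ^+ 2 <= chord2 r ->
  exists p, hball (net_point delta p) r y.
Proof.
move=> d0 r0 dr; have t0 := height_gt0 y.
have l0 : 0 < ln (1 + delta) by apply: ln_gt0; lra.
pose k := Num.floor (layer_coord delta y).
exists (k, [ffun i => Num.floor (base_coord delta k y i)]).
apply/hballE => //.
rewrite /sqdist /=.
set s := expR _; have s0 : 0 < s by exact: expR_gt0.
have := floor_itv (layer_coord delta y); rewrite -/k intrD => /andP[k1 k2].
have st : s <= height y.
  by rewrite -(lnK t0) ler_expR -ler_pdivlMr.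
have ts : height y <= s * (1 + delta).
  rewrite -(@lnK _ (1 + delta)) ?posrE; last by lra.
  rewrite -expRD -(lnK t0) ler_expR.
  by move: k2; rewrite /layer_coord ltr_pdivrMr// => k2; lra.
have base_le i : (hbase y 0 i - (\row_i0 (delta * s *
    ([ffun i1 => Num.floor (base_coord delta k y i1)] i0)%:~R)) 0 i) ^+ 2
    <= (delta * s) ^+ 2.
  rewrite mxE ffunE.
  have := floor_itv (base_coord delta k y i); rewrite intrD => /andP[f1 f2].
  have ds0 : 0 < delta * s by rewrite mulr_gt0.
  move: f1 f2; rewrite /base_coord -/s ler_pdivlMr// ltr_pdivrMr//.
  move: (_%:~R) => n n1 n2; rewrite ler_sqr ?nnegrE; nra.
apply: (@le_trans _ _ ((d.-1).+1%:R * delta ^+ 2 * (height y * s))); last first.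
  by rewrite ler_pM2r// mulr_gt0.
apply: (@le_trans _ _ ((d.-1).+1%:R * (delta * s) ^+ 2)); last first.
  by rewrite exprMn [leLHS]mulrA ler_pM2l ?mulr_gt0 ?exprn_gt0// expr2 ler_pM2r.
rewrite -natr1 mulrDl mul1r lerD//; last by rewrite ler_sqr ?nnegrE; nra.
apply: (le_trans (ler_sum _ (fun i _ => base_le i))).
by rewrite sumr_const card_ord mulr_natl.
Qed.

(** The net points whose index is within N of the rounded coordinates of y, the
    base being rounded relative to the layer of the net point, not that of y. *)
Definition net_window {R : realType} {d : nat} (delta : R) (N : nat)
    (y : hyperbolic R d)
    (w : 'I_(N.*2.+1) * {ffun 'I_d.-1 -> 'I_(N.*2.+1)}) : hyperbolic R d :=
  let k := Num.floor (layer_coord delta y) + w.1%:Z - N%:Z in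
  net_point delta
    (k, [ffun i => Num.floor (base_coord delta k y i) + (w.2 i)%:Z - N%:Z]).

(** Both estimates come from |y - x|^2 <= kappa s t, where s and t are the heights
    of x and y: the vertical part (t - s)^2 <= kappa s t forces s and t to be
    within a factor kappa + 2, and then the horizontal part is at most
    kappa (kappa + 2) s^2. *)
Lemma net_point_window {R : realType} {d : nat} (delta r : R) (N : nat) :
  0 < delta -> 0 < r ->
  (Num.truncn (ln (chord2 r + 2) / ln (1 + delta) + (chord2 r + 2) / delta) + 2
     <= N)%N ->
  forall (y : hyperbolic R d) p, hball (net_point delta p) r y ->
  range (net_window delta N y) (net_point delta p).
Proof.
move=> d0 r0; have := chord2_gt0 r r0; set K := chord2 r => K0.
set L := _ + _ => LN y [k n] /(hballE _ _ _ (ltW r0)); rewrite -/K /sqdist /=.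
set s := expR _ => dist_le.
have s0 : 0 < s by exact: expR_gt0.
have t0 := height_gt0 y; set t := height y in t0 dist_le *.
have l0 : 0 < ln (1 + delta) by apply: ln_gt0; lra.
have lK0 : 0 <= ln (K + 2) by apply: ln_ge0; lra.
have Kd0 : 0 <= (K + 2) / delta by rewrite divr_ge0//; lra.
have sum0 : 0 <= \sum_(i < d.-1)
    (hbase y 0 i - (\row_i0 (delta * s * (n i0)%:~R)) 0 i) ^+ 2.
  by apply: sumr_ge0 => i _; exact: sqr_ge0.
have vert : (t - s) ^+ 2 <= K * (t * s) by lra.
have sKt : s <= (K + 2) * t by rewrite -(ler_pM2r s0); nra.
have tKs : t <= (K + 2) * s by rewrite -(ler_pM2r t0); nra.
have [j kj] : exists j : 'I_(N.*2.+1),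
    k = Num.floor (layer_coord delta y) + j%:Z - N%:Z.
  apply: (int_near_floor _ L) => //.
  have layerE : (k%:~R - layer_coord delta y) * ln (1 + delta) = ln s - ln t.
    by rewrite mulrBl /layer_coord divfK ?gt_eqF// expRK.
  have lnst : `|ln s - ln t| <= ln (K + 2).
    have K2 : 0 < K + 2 by lra.
    have ln_s : ln s <= ln (K + 2) + ln t.
      by rewrite -lnM ?posrE// ler_ln ?posrE ?mulr_gt0.
    have ln_t : ln t <= ln (K + 2) + ln s.
      by rewrite -lnM ?posrE// ler_ln ?posrE ?mulr_gt0.
    by rewrite ler_norml; apply/andP; split; lra.
  rewrite -layerE normrM (gtr0_norm l0) -ler_pdivlMr// in lnst.
  by apply: (le_trans lnst); rewrite lerDl.
have base_near i : exists m : 'I_(N.*2.+1),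
    n i = Num.floor (base_coord delta k y i) + m%:Z - N%:Z.
  apply: (int_near_floor _ L) => //.
  have ds0 : 0 < delta * s by rewrite mulr_gt0.
  have baseE : ((n i)%:~R - base_coord delta k y i) * (delta * s) =
      - (hbase y 0 i - delta * s * (n i)%:~R).
    by rewrite mulrBl /base_coord -/s divfK ?gt_eqF//; ring.
  have horiz : (hbase y 0 i - delta * s * (n i)%:~R) ^+ 2 <= ((K + 2) * s) ^+ 2.
    apply: (@le_trans _ _ (K * (t * s))); last by nra.
    apply: le_trans dist_le; rewrite (bigD1 i)//= mxE -addrA lerDl.
    by rewrite addr_ge0 ?sqr_ge0// sumr_ge0// => ? _; rewrite sqr_ge0.
  have : `|(n i)%:~R - base_coord delta k y i| * (delta * s) <= (K + 2) * s.
    rewrite -{1}(gtr0_norm ds0) -normrM baseE normrN.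
    rewrite -ler_sqr ?nnegrE ?normr_ge0// ?real_normK ?num_real//.
    by rewrite mulr_ge0 ?ltW//; lra.
  rewrite mulrA ler_pM2r// -ler_pdivlMr// => /le_trans; apply.
  by rewrite lerDr divr_ge0// ltW.
have [m nm] := boolp.choice base_near.
exists (j, [ffun i => m i]) => //.
rewrite /net_window /= -kj; congr (net_point delta (k, _)).
by apply/ffunP => i; rewrite !ffunE; exact/esym/nm.
Qed.

Theorem hyperbolic_net {R : realType} (d : nat) (r : R) : 0 < r ->
  exists (M : set (hyperbolic R d)) (c : nat),
    [/\ countable M,
        \bigcup_(x in M) hball x r = [set: hyperbolic R d]
      & forall y : hyperbolic R d, [set x | M x /\ hball x r y] #<= `I_c].
Proof.
move=> r0; have K0 := chord2_gt0 r r0.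
(* As delta <= 1 gives delta^2 <= delta, the quadratic mesh condition follows
   from a linear bound on delta. *)
pose delta := Num.min 1 (chord2 r / (d.-1).+1%:R).
have d0 : 0 < delta by rewrite lt_min ltr01 divr_gt0.
have mesh : (d.-1).+1%:R * delta ^+ 2 <= chord2 r.
  have d1 : delta <= 1 by rewrite ge_min lexx.
  have : delta <= chord2 r / (d.-1).+1%:R by rewrite ge_min lexx orbT.
  rewrite ler_pdivlMr// => dK; apply: le_trans dK.
  by rewrite mulrC ler_pM2r// expr2 ler_piMl// ltW.
pose N := (Num.truncn (ln (chord2 r + 2) / ln (1 + delta) +
                       (chord2 r + 2) / delta) + 2)%N.
exists (range (@net_point R d delta)).
exists #|{: 'I_(N.*2.+1) * {ffun 'I_d.-1 -> 'I_(N.*2.+1)}}|; split.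
- by apply: card_le_trans (card_image_le _ _) _; exact: countableP.
- apply/seteqP; split=> // y _.
  have [p yp] := net_point_cover delta r y d0 (ltW r0) mesh.
  by exists (net_point delta p) => //; exists p.
- move=> y.
  apply: (@range_card_le _ _ _ (net_window delta N y)) => _ [[p _ <-] yp].
  by apply: net_point_window yp.
Qed.

Theorem lemma9p1 (R : realType) (d : nat) (hd : (2 <= d)%N) :
  exists (M : set (hyperbolic R d)) (c : nat),
    [/\ countable M,
        \bigcup_(x in M) hball x (1 / 2) = [set: hyperbolic R d]
      & forall y : hyperbolic R d,
          [set x | M x /\ hball x (1 / 2) y] #<= `I_c].
Proof. by apply: hyperbolic_net; rewrite divr_gt0. Qed.
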